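(* Let $R,Q,\lambda,\mu>0$. Two units in parallel, both from $x$ to $y$, of respective parameters $(R,\lambda)$ and $(Q,\mu)$, can be replaced by a single unit from $x$ to $y$ of parameters $$\Bigl(\frac{RQ}{R+Q},\ \frac{Q(\mu+1)}{Q(\mu+1)+R(\lambda+1)}\cdot\lambda+\frac{R(\lambda+1)}{Q(\mu+1)+R(\lambda+1)}\cdot\mu\Bigr).$$
   Context: A unit of parameters $(R,\lambda)$ from $x$ to $y$ ($R,\lambda>0$) consists of a resistor $R/2$, then a voltage amplifier multiplying the potential by $\lambda$ in the direction from $x$ to $y$, then another resistor $R/2$. With potentials $u_x,u_y$ at its ends, the current $i_{xy}=-i_{yx}$ through it from $x$ to $y$ is determined by $u_y=\bigl(u_x-i_{xy}\frac R2\bigr)\lambda-i_{xy}\frac R2$, i.e. $i_{xy}=\frac{2}{R(1+\lambda)}(\lambda u_x-u_y)$. In parallel means that both units connect the same vertices $x$ and $y$, and the total current from $x$ to $y$ is the sum of the currents through the two units. ''Can be replaced by'' means that for all potentials $u_x,u_y\in\mathbb R$, the total current from $x$ to $y$ is the same for the combination and for the single unit. *)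

(* Defs.v *)
From Stdlib Require Import Reals Lra.
Open Scope R_scope.

(** Admissible parameters of a unit. *)
Definition unit_params (r lam : R) : Prop := 0 < r /\ 0 < lam.

(** The circuit equation of the unit (r, lam) from x to y: starting from the
    potential [ux], the current [i] crosses a resistor r/2, the potential is
    multiplied by lam, and [i] crosses another resistor r/2 to reach [uy]. *)
Definition unit_law (r lam ux uy i : R) : Prop :=
  uy = (ux - i * (r / 2)) * lam - i * (r / 2).

(** A two-terminal element from x to y is represented by the current from x
    to y that it carries, as a function of the end potentials ux and uy. *)
Definition element : Type := R -> R -> R.

Definition unit_element (r lam : R) : element :=
  fun ux uy => 2 / (r * (1 + lam)) * (lam * ux - uy).

Lemma unit_elementP (r lam ux uy i : R) :
  unit_params r lam ->
  (unit_law r lam ux uy i <-> i = unit_element r lam ux uy).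
Proof.
  intros [Hr Hlam]. unfold unit_law, unit_element.
  assert (Hc : r * (1 + lam) <> 0).
  { apply Rmult_integral_contrapositive; lra. }
  split; intros H.
  - apply (Rmult_eq_reg_l (r * (1 + lam))); [| exact Hc].
    rewrite H. field. lra.
  - rewrite H. field. lra.
Qed.

Definition parallel (e f : element) : element :=
  fun ux uy => e ux uy + f ux uy.

Definition can_be_replaced_by (e f : element) : Prop :=
  forall ux uy : R, e ux uy = f ux uy.

(* Main.v *)
Require Import Defs.
From Stdlib Require Import Reals Lra.
Open Scope R_scope.

(** A unit (r, lam) carries the current c * (lam * ux - uy), where
    c = 2 / (r * (1 + lam)) acts as a conductance.  Adding the currents of two
    such units with conductances a and b gives
    (a * lam + b * mu) * ux - (a + b) * uy, which is the law of a unit with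
    conductance a + b whose gain is the average of lam and mu weighted by
    a and b.  Multiplying these weights by r * (lam + 1) * q * (mu + 1) / 2
    turns them into q * (mu + 1) and r * (lam + 1), so the average is nu; it is
    positive as a combination of positive gains with positive weights.

    The resistance s is then forced by 2 / (s * (1 + nu)) = a + b.  It is free
    of the gains because 1 + nu factors ([one_plus_parallel_gain]), and the
    factors 1 + lam and 1 + mu cancel, leaving the usual parallel
    resistance. *)

(** The numerator q * (mu + 1) * (lam + 1) + r * (lam + 1) * (mu + 1) of the
    left-hand side has (lam + 1) * (mu + 1) as a common factor: this is what
    makes the equivalent resistance independent of the gains. *)
Lemma one_plus_parallel_gain (r q lam mu : R) :
  q * (mu + 1) + r * (lam + 1) <> 0 ->
  1 + (q * (mu + 1) / (q * (mu + 1) + r * (lam + 1)) * lam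
       + r * (lam + 1) / (q * (mu + 1) + r * (lam + 1)) * mu)
  = (r + q) * (lam + 1) * (mu + 1) / (q * (mu + 1) + r * (lam + 1)).
Proof. intros H. field. exact H. Qed.

Theorem proposition4p2
  (r q lam mu : R) (hr : 0 < r) (hq : 0 < q) (hlam : 0 < lam) (hmu : 0 < mu) :
  let s := r * q / (r + q) in
  let nu := q * (mu + 1) / (q * (mu + 1) + r * (lam + 1)) * lam
            + r * (lam + 1) / (q * (mu + 1) + r * (lam + 1)) * mu in
  unit_params s nu /\
  can_be_replaced_by (parallel (unit_element r lam) (unit_element q mu))
                     (unit_element s nu).
Proof.
  intros s nu.
  assert (Hq : 0 < q * (mu + 1)) by (apply Rmult_lt_0_compat; lra).
  assert (Hr : 0 < r * (lam + 1)) by (apply Rmult_lt_0_compat; lra).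
  split.
  - split.
    + apply Rdiv_lt_0_compat; [apply Rmult_lt_0_compat|]; lra.
    + apply Rplus_lt_0_compat; apply Rmult_lt_0_compat; try assumption;
        apply Rdiv_lt_0_compat; lra.
  - intros ux uy. unfold parallel, unit_element.
    (* Factoring 1 + nu first keeps the denominator of the single unit a
       product, so that its nonvanishing is a matter of signs. *)
    replace (1 + nu) with
      ((r + q) * (lam + 1) * (mu + 1) / (q * (mu + 1) + r * (lam + 1)))
      by (symmetry; apply one_plus_parallel_gain; lra).
    unfold s, nu. field. repeat split; lra.
Qed.
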